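(* Let $J$ be James space with its boundedly complete basis $(e_i)_i$, let $s_{[1,n]}=\sum_{i=1}^ne_i^*\in J^*$ for $n\in\mathbb{N}$, and let $Y$ be the closed linear span of $(s_{[1,n]})_n$ in $J^*$. The basis $(s_{[1,n]})_n$ of $Y$ is convex block homogeneous but not equivalent to the jamesification of any subsymmetric sequence.
   Context: Banach spaces are real. James space $J$ is the completion of $c_{00}(\mathbb{N})$, with unit vector basis $(e_i)_i$, under the norm $$\Big\|\sum_ia_ie_i\Big\|=\sup\Big\{\Big(\sum_{k=1}^n\Big(\sum_{i\in E_k}a_i\Big)^2\Big)^{1/2}\Big\},$$ the supremum being taken over all choices of successive intervals $(E_k)_{k=1}^n$ of $\mathbb{N}$ (gaps allowed). $(e_i^* )_i$ are the functionals biorthogonal to $(e_i)_i$. Two sequences are equivalent if the norms of their finite linear combinations with the same coefficients are comparable up to uniform positive constants. A sequence is subsymmetric if it is unconditional and spreading (equivalent to all of its subsequences). The jamesification of a subsymmetric sequence $(x_i)_i$ is the unit vector basis of $c_{00}(\mathbb{N})$ endowed with the norm $$\|(a_i)_i\|=\sup\Big\{\Big\|\sum_{k=1}^n\Big(\sum_{i\in E_k}a_i\Big)x_k\Big\|\Big\},$$ the supremum being over all choices of successive intervals $(E_k)_{k=1}^n$ of $\mathbb{N}$ (gaps allowed). A convex block sequence of $(x_i)_i$ is a sequence $(w_k)_k$ with $w_k=\sum_{i\in F_k}c_ix_i$, where $F_1<F_2<\cdots$ are successive finite subsets of $\mathbb{N}$, $c_i\geqslant0$ and $\sum_{i\in F_k}c_i=1$.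 A Schauder basic sequence is convex block homogeneous if it is equivalent to each of its convex block sequences. *)

(* Defs.v *)
From HB Require Import structures.
From mathcomp Require Import all_boot all_order all_algebra finmap.
From mathcomp Require Import all_classical all_reals all_analysis.
Set Implicit Arguments.
Unset Strict Implicit.
Unset Printing Implicit Defensive.
Import Order.TTheory GRing.Theory Num.Theory.
Import numFieldNormedType.Exports.
Local Open Scope classical_set_scope.
Local Open Scope ring_scope.

Section Dual.
Variables (R : realType) (X : normedModType R).

Definition dual_pred : {pred X -> R^o} :=
  [pred f : X -> R^o | `[< linear f /\ continuous f >]].

Lemma dual_predP (f : X -> R^o) :
  reflect (linear f /\ continuous f) (f \in dual_pred).
Proof. by rewrite inE /=; exact: asboolP. Qed.

Record dual := Dual {
  dual_fun :> X -> R^o;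
  dual_funP : dual_fun \in dual_pred }.

HB.instance Definition _ := [isSub for dual_fun].
HB.instance Definition _ := [Choice of dual by <:].

Lemma dual_submod_closed : submod_closed dual_pred.
Proof.
split.
  apply/dual_predP; split; last exact: cst_continuous.
  by move=> a x y; rewrite /= scaler0 addr0.
move=> a f g /dual_predP[fl fc] /dual_predP[gl gc].
apply/dual_predP; split.
  move=> b x y; rewrite !fctE fl gl !scalerDr !scalerA mulrC.
  by rewrite -!addrA; congr (_ + _); rewrite addrCA.
move=> x; apply: (@cvgD _ _ _ _ _ (a \*: f) g); last exact: gc.
by apply: cvgZ; [exact: cvg_cst | exact: fc].
Qed.

HB.instance Definition _ :=
  GRing.isSubmodClosed.Build R (X -> R^o) dual_pred dual_submod_closed.
HB.instance Definition _ := [SubChoice_isSubLmodule of dual by <:].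

Definition dual_norm (f : dual) : R :=
  sup [set `|f x| | x in [set x : X | `|x| <= 1]].

Let valD (f g : dual) x : (f + g) x = f x + g x. Proof. by []. Qed.

Let valZ a (f : dual) x : (a *: f) x = a * f x. Proof. by []. Qed.

Let scaleE (f : dual) (a : R) x : f (a *: x) = a * f x.
Proof.
have /dual_predP[fl _] := dual_funP f.
have f0 : f 0 = 0.
  by have := fl (-1) 0 0; rewrite scaler0 addr0 scaleN1r addNr.
by have := fl a x 0; rewrite f0 !addr0.
Qed.

Lemma dual_norm_has_sup (f : dual) :
  has_sup [set `|f x| | x in [set x : X | `|x| <= 1]].
Proof.
split; first by exists `|f 0|, 0 => //=; rewrite normr0.
have /dual_predP[fl fc] := dual_funP f.
pose L := GRing.isLinear.Build R X R^o *:%R f fl.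
pose F : {linear X -> R^o} := HB.pack (f : X -> R^o) L.
have /bounded_funP/(_ 1)[M FM] : bounded_near F (nbhs (0 : X)).
  by apply/linear_bounded_continuous; exact: fc.
by exists M => _ [x x1 <-]; exact: FM.
Qed.

Lemma ler_dual_norm (f : dual) x : `|f x| <= dual_norm f * `|x|.
Proof.
have [->|x0] := eqVneq x 0.
  by rewrite -(scale0r (0 : X)) scaleE mul0r scale0r !normr0 mulr0.
have n0 : 0 < `|x| by rewrite normr_gt0.
rewrite -ler_pdivrMr //.
have -> : `|f x| / `|x| = `|f (`|x|^-1 *: x)|.
  by rewrite scaleE normrM normfV normr_id mulrC.
apply: sup_upper_bound; first exact: dual_norm_has_sup.
exists (`|x|^-1 *: x) => //=.
by rewrite normrZ normfV normr_id mulVf // gt_eqF.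
Qed.

Let dual_normD (f g : dual) : dual_norm (f + g) <= dual_norm f + dual_norm g.
Proof.
apply: ge_sup; first by case: (dual_norm_has_sup (f + g)).
move=> _ [x x1 <-]; rewrite valD (le_trans (ler_normD _ _)) //.
by apply: lerD; apply: sup_upper_bound; (exact: dual_norm_has_sup || exists x).
Qed.

Let dual_norm_ge0 (f : dual) : 0 <= dual_norm f.
Proof.
apply: le_trans (_ : `|f 0| <= _); first exact: normr_ge0.
apply: sup_upper_bound; first exact: dual_norm_has_sup.
by exists 0 => //=; rewrite normr0.
Qed.

Let dual_normZ_le a (f : dual) : dual_norm (a *: f) <= `|a| * dual_norm f.
Proof.
apply: ge_sup; first by case: (dual_norm_has_sup (a *: f)).
move=> _ [x x1 <-]; rewrite valZ normrM ler_wpM2l //.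
by apply: sup_upper_bound; (exact: dual_norm_has_sup || exists x).
Qed.

Let dual_normZ a (f : dual) : dual_norm (a *: f) = `|a| * dual_norm f.
Proof.
apply/le_anti; rewrite dual_normZ_le /=.
have [->|a0] := eqVneq a 0; first by rewrite normr0 mul0r dual_norm_ge0.
rewrite -ler_pdivlMl ?normr_gt0 // -normfV.
by rewrite -{1}(scale1r f) -(mulVf a0) -scalerA dual_normZ_le.
Qed.

Let dual_norm_eq0 (f : dual) : dual_norm f = 0 -> f = 0.
Proof.
move=> f0; apply/val_inj/funext => x; apply/normr0_eq0/le_anti.
by rewrite normr_ge0 andbT (le_trans (ler_dual_norm f x)) // f0 mul0r.
Qed.

HB.instance Definition _ :=
  Lmodule_isNormed.Build R dual dual_normD dual_normZ dual_norm_eq0.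

End Dual.

(** The pair (n, a) stands for the
    vector (a_0, ..., a_(n-1), 0, 0, ...) of c_00; norms on c_00 are written as
    functions of such pairs.  Indices start at 0. *)

Section Sequences.
Variables (R : realType) (X : normedModType R).
Implicit Types (x w : nat -> X) (a : nat -> R).

Definition lin_comb x (n : nat) a : X := \sum_(i < n) a i *: x i.

Definition seq_norm x (n : nat) a : R := `|lin_comb x n a|.

Definition equivalent (N M : nat -> (nat -> R) -> R) : Prop :=
  exists A B : R, [/\ 0 < A, 0 < B &
    forall n a, A * M n a <= N n a /\ N n a <= B * M n a].

Definition closed_span x : set X :=
  closure [set y | exists n a, y = lin_comb x n a].

Definition schauder_basis x (Y : set X) : Prop :=
  (forall i, Y (x i)) /\
  forall y, Y y -> exists! a : nat -> R, lin_comb x n a @[n --> \oo] --> y.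

Definition schauder_basic x : Prop := schauder_basis x (closed_span x).

Definition unconditional x : Prop :=
  schauder_basic x /\
  exists K : R, forall n a (eps : nat -> bool),
    seq_norm x n (fun i => (-1) ^+ eps i * a i) <= K * seq_norm x n a.

Definition spreading x : Prop :=
  forall phi : nat -> nat, {homo phi : i j / (i < j)%N} ->
    equivalent (seq_norm x) (seq_norm (x \o phi)).

Definition subsymmetric x : Prop := unconditional x /\ spreading x.

Definition convex_block x w : Prop :=
  exists (F : nat -> {fset nat}) (c : nat -> R),
    [/\ forall k i j, i \in F k -> j \in F k.+1 -> (i < j)%N,
        forall k i, i \in F k -> 0 <= c i,
        forall k, \sum_(i <- F k) c i = 1 &
        forall k, w k = \sum_(i <- F k) c i *: x i].

Definition convex_block_homogeneous x : Prop :=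
  schauder_basic x /\
  forall w, convex_block x w -> equivalent (seq_norm x) (seq_norm w).

End Sequences.

(** A pair (l, r) with l < r stands for the nonempty interval {l, ..., r-1}.
    Infinite intervals are not needed: on a finitely supported vector they give
    the same sums as long enough finite ones. *)

Definition successive_intervals (s : seq (nat * nat)) : bool :=
  all (fun E => E.1 < E.2)%N s && sorted (fun E E' => E.2 <= E'.1)%N s.

Section Jamesification.
Variable R : realType.
Implicit Types (n : nat) (a : nat -> R).

Definition interval_sum n a (E : nat * nat) : R :=
  \sum_(E.1 <= i < E.2 | (i < n)%N) a i.

Definition james_norm n a : R :=
  sup [set Num.sqrt (\sum_(E <- s) interval_sum n a E ^+ 2)
      | s in [set s | successive_intervals s]].

Definition jamesification_norm (X : normedModType R) (x : nat -> X) n a : R :=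
  sup [set seq_norm x (size s) (fun k => interval_sum n a (nth (0, 0)%N s k))
      | s in [set s | successive_intervals s]].

(** [J] is the completion of c_00 under the James norm, [e] being the image of
    the unit vector basis; this determines (J, e) up to isometric isomorphism. *)
Definition james_space (J : completeNormedModType R) (e : nat -> J) : Prop :=
  (forall n a, seq_norm e n a = james_norm n a) /\ closed_span e = setT.

Definition biorthogonal (X : normedModType R) (e : nat -> X)
    (f : nat -> dual X) : Prop :=
  forall i j, f i (e j) = (i == j)%:R.

End Jamesification.

(* Main.v *)
(** A functional [sum_n a_n s_n] maps the vector with partial sums [t] to
    [sum_n a_n t_n], and the James norm of that vector is the 2-variation of
    [t] started at 0, which does not increase when [t] is reparametrised
    monotonically.  Hence [sum_k a_k s_(i_k)] with [i_k] in [F_k] has norm at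
    most that of [sum_k a_k s_k], and so has the average
    [sum_k a_k w_k] of such vectors.  Conversely, every [t] can be spread out
    so as to be constant on each [F_k], so [(w_k)_k] is even isometrically
    equivalent to [(s_k)_k].

    The vectors [sum_k b_k (s_2k - s_(2k+1))] have norm at most [|b|_2], so if
    [s] is equivalent to the jamesification of [x], then [x] is dominated by
    the basis of l_2 and [s] by the basis of [J].  This would bound the form
    [(a, x) |-> sum_i a_i sum_(j <= i) x_j] by the James norms of [a] and [x].
    As for Young's integral at the critical exponents 1/2 + 1/2 = 1, no such
    bound holds: superpose [n] square waves of amplitude [2^-k] and
    half-period [2 * 4^k], with a quarter period shift between [a] and [x].
    On [4^n] indices both James norms are O(2^n), but every scale contributes
    [4^n / 2] to the form. *)

From HB Require Import structures.
Require Import Defs.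
From mathcomp Require Import all_boot all_order all_algebra finmap.
From mathcomp Require Import all_classical all_reals all_analysis.
From mathcomp Require Import zify ring lra.
Import Order.TTheory GRing.Theory Num.Theory.
Import numFieldNormedType.Exports.
Local Open Scope classical_set_scope.
Local Open Scope ring_scope.
Set Implicit Arguments.
Unset Strict Implicit.
Unset Printing Implicit Defensive.

(** * Interval sums, the James norm and monotone reparametrisation *)

Section JamesNorm.
Variable R : realType.
Implicit Types (n m : nat) (a x : nat -> R) (s : seq (nat * nat)).

Lemma interval_sum_prefix n a l r : (l <= r)%N ->
  interval_sum n a (l, r) = interval_sum n a (0, r)%N - interval_sum n a (0, l)%N.
Proof.
move=> lr; rewrite /interval_sum /= [X in _ = X - _](@big_cat_nat _ _ _ l) //=.
by rewrite addrAC subrr add0r.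
Qed.

Lemma interval_sumS n a r :
  interval_sum n a (0, r.+1)%N =
  interval_sum n a (0, r)%N + (if (r < n)%N then a r else 0).
Proof.
by rewrite /interval_sum /= big_mkcond big_nat_recr //= -big_mkcond.
Qed.

Lemma interval_sum_widen n a r :
  interval_sum n a (0, r)%N = \sum_(i < n | (i < r)%N) a i.
Proof.
rewrite /interval_sum /= big_mkord.
have [rn|nr] := leqP r n.
  rewrite (big_ord_narrow rn); apply: eq_big => i //=.
  by rewrite (leq_trans (ltn_ord i) rn).
rewrite (big_ord_narrow (ltnW nr)); apply: eq_bigl => i /=.
by rewrite (ltn_trans (ltn_ord i) nr).
Qed.

(* The cut-off at [m] is harmless since intervals are truncated at [m] first. *)
Lemma interval_sum_reparam n a m (psi : nat -> nat) l r :
    {homo psi : i j / (i <= j)%N} -> (l <= r)%N ->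
  interval_sum m (fun k => interval_sum n a (psi k, psi k.+1)) (l, r) =
  interval_sum n a (psi (minn l m), psi (minn r m)).
Proof.
move=> psiM lr.
have pre k : interval_sum m (fun k => interval_sum n a (psi k, psi k.+1)) (0, k)%N
    = interval_sum n a (0, psi (minn k m))%N - interval_sum n a (0, psi 0)%N.
  elim: k => [|k IH]; first by rewrite min0n subrr /interval_sum big_nil.
  rewrite interval_sumS IH.
  have [km|mk] := ltnP k m; last by rewrite addr0 (minn_idPr (leqW mk)).
  by rewrite (minn_idPl km) (@interval_sum_prefix _ _ (psi k)) ?psiM //; ring.
have minM : (minn l m <= minn r m)%N by lia.
by rewrite interval_sum_prefix // !pre [RHS]interval_sum_prefix ?psiM //; ring.
Qed.

(** Empty intervals are allowed because a monotone reparametrisation may collapse an interval. They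
    contribute zero to the James sums. *)
Definition weakly_successive s :=
  all (fun E => E.1 <= E.2)%N s && sorted (fun E E' => E.2 <= E'.1)%N s.

Lemma successiveW s : successive_intervals s -> weakly_successive s.
Proof.
by case/andP=> /allP sp ss; apply/andP; split=> //; apply/allP => E /sp /ltnW.
Qed.

Lemma weakly_successive_filter s : weakly_successive s ->
  successive_intervals [seq E <- s | (E.1 < E.2)%N].
Proof.
case/andP=> sp ss; rewrite /successive_intervals filter_all /=.
apply: (@sorted_filter_in _ (fun E => E.1 <= E.2)%N) ss => // E F G.
rewrite !unfold_in => Ele _ _ FE EG; exact: leq_trans FE (leq_trans Ele EG).
Qed.

Lemma weakly_successive_map s (psi : nat -> nat) :
  {homo psi : i j / (i <= j)%N} -> weakly_successive s ->
  weakly_successive [seq (psi E.1, psi E.2) | E <- s].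
Proof.
move=> psiM /andP[sp ss]; apply/andP; split.
  by rewrite all_map; apply: sub_all sp => E /=; exact: psiM.
by rewrite sorted_map; apply: sub_sorted ss => E F /=; exact: psiM.
Qed.

(** Telescoping: the increments of [G] over the gaps are nonnegative, so dropping them only
    decreases the sum. *)
Lemma sum_increments_le s (G : nat -> R) (M : R) :
  {homo G : i j / (i <= j)%N >-> i <= j} -> (forall i, G i <= M) ->
  weakly_successive s -> \sum_(E <- s) (G E.2 - G E.1) <= M - G 0%N.
Proof.
(* The induction is generalised to lists that continue an arbitrary interval [p]; the claim is the
   case [p = (0, 0)]. *)
move=> GM GB; case/andP => sp; suff H p : all (fun E => E.1 <= E.2)%N s ->
    path (fun E E' => E.2 <= E'.1)%N p s ->
    \sum_(E <- s) (G E.2 - G E.1) <= M - G p.2.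
  move=> ss; apply: (H (0, 0)%N) => //.
  by case: {H sp} s ss => //= E s ->.
elim: s p {sp} => [|E s IH] p /=; first by rewrite big_nil subr_ge0.
move=> /andP[E12 sp] /andP[pE ss]; rewrite big_cons.
have := IH _ sp ss; have := GM _ _ pE; lra.
Qed.

Lemma sum_sqr_le (I : Type) (r : seq I) (u : I -> R) :
  \sum_(i <- r) u i ^+ 2 <= (\sum_(i <- r) `|u i|) ^+ 2.
Proof.
elim: r => [|i r IH]; first by rewrite !big_nil expr0n.
rewrite !big_cons sqrrD real_normK ?num_real //.
have : 0 <= `|u i| * \sum_(j <- r) `|u j| by rewrite mulr_ge0 // sumr_ge0.
lra.
Qed.

(** The intervals are disjoint, so the l_1 norm dominates. This makes the supremum in [james_norm]
    finite. *)
Lemma james_sum_bound n a s : successive_intervals s ->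
  \sum_(E <- s) interval_sum n a E ^+ 2 <= (\sum_(i < n) `|a i|) ^+ 2.
Proof.
move=> /successiveW ss; apply: le_trans (sum_sqr_le _ _) _.
rewrite lerXn2r ?nnegrE ?sumr_ge0 //.
pose G k := interval_sum n (fun i => `|a i|) (0, k)%N.
have G0 : G 0%N = 0 by rewrite /G /interval_sum big_nil.
have GM : {homo G : i j / (i <= j)%N >-> i <= j}.
  move=> i j ij; rewrite -subr_ge0 /G -interval_sum_prefix //.
  by rewrite sumr_ge0.
apply: le_trans (_ : \sum_(E <- s) (G E.2 - G E.1) <= _).
  rewrite big_seq [leRHS]big_seq; apply: ler_sum => -[l r] Es /=.
  have lr : (l <= r)%N by case/andP: ss => /allP /(_ _ Es).
  by rewrite /G -interval_sum_prefix //; apply: ler_norm_sum.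
suff GB k : G k <= \sum_(i < n) `|a i|.
  by have := sum_increments_le GM GB ss; rewrite G0 subr0.
rewrite /G interval_sum_widen big_mkcond /=; apply: ler_sum => i _.
by case: ifP.
Qed.

Lemma james_norm_has_sup n a :
  has_sup [set Num.sqrt (\sum_(E <- s) interval_sum n a E ^+ 2)
          | s in [set s | successive_intervals s]].
Proof.
split; first by exists (Num.sqrt (\sum_(E <- [::]) interval_sum n a E ^+ 2)), [::].
exists (\sum_(i < n) `|a i|) => _ [s ss <-].
by rewrite -(ler_sqr) ?nnegrE ?sqrtr_ge0 ?sumr_ge0 // sqr_sqrtr
  ?sumr_ge0 ?james_sum_bound // => i _; exact: sqr_ge0.
Qed.

Lemma james_norm_ge0 n a : 0 <= james_norm n a.
Proof.
apply: sup_upper_bound; first exact: james_norm_has_sup.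
by exists [::] => //=; rewrite big_nil sqrtr0.
Qed.

Lemma sum_le_james_norm n a s : weakly_successive s ->
  \sum_(E <- s) interval_sum n a E ^+ 2 <= james_norm n a ^+ 2.
Proof.
move=> ss; rewrite (bigID (fun E => E.1 < E.2)%N) /= [X in _ + X]big1 ?addr0.
  rewrite -big_filter; set t := [seq E <- s | _].
  have sum0 : 0 <= \sum_(E <- t) interval_sum n a E ^+ 2.
    by rewrite sumr_ge0 // => E _; exact: sqr_ge0.
  rewrite -(sqr_sqrtr sum0) lerXn2r ?nnegrE ?sqrtr_ge0 ?james_norm_ge0 //.
  apply: sup_upper_bound; first exact: james_norm_has_sup.
  by exists t => //; exact: weakly_successive_filter.
by move=> E; rewrite -leqNgt /interval_sum => E21; rewrite big_geq // expr0n.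
Qed.

Lemma james_norm_le n a (M : R) : 0 <= M ->
  (forall s, successive_intervals s ->
    \sum_(E <- s) interval_sum n a E ^+ 2 <= M ^+ 2) -> james_norm n a <= M.
Proof.
move=> M0 H; apply: ge_sup; first by case: (james_norm_has_sup n a).
move=> _ [s ss <-]; rewrite -(@ler_sqr) ?nnegrE ?sqrtr_ge0 // sqr_sqrtr ?H //.
by rewrite sumr_ge0 // => E _; exact: sqr_ge0.
Qed.

(** Each interval sum of the new vector is the sum of [a] over the image interval under [psi], and
    these images are again successive up to empty ones. *)
Lemma james_norm_reparam n a m (psi : nat -> nat) :
    {homo psi : i j / (i <= j)%N} ->
  james_norm m (fun k => interval_sum n a (psi k, psi k.+1)) <= james_norm n a.
Proof.
move=> psiM; apply: james_norm_le => [|s ss]; first exact: james_norm_ge0.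
pose phi k := psi (minn k m).
have phiM : {homo phi : i j / (i <= j)%N} by move=> i j ij; apply: psiM; lia.
rewrite (_ : \sum_(E <- s) _ =
  \sum_(E <- [seq (phi E.1, phi E.2) | E <- s]) interval_sum n a E ^+ 2).
  by apply/sum_le_james_norm/weakly_successive_map/successiveW.
rewrite big_map big_seq [RHS]big_seq; apply: eq_bigr => -[l r] Es.
rewrite interval_sum_reparam //.
by case/andP: (successiveW ss) => /allP /(_ _ Es).
Qed.

Lemma interval_sum_le_james_norm n a l r : (l <= r)%N ->
  `|interval_sum n a (l, r)| <= james_norm n a.
Proof.
move=> lr; rewrite -ler_sqr ?nnegrE ?james_norm_ge0 // real_normK ?num_real //.
have := @sum_le_james_norm n a [:: (l, r)].
by rewrite big_seq1; apply; rewrite /weakly_successive /= lr.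
Qed.

Lemma james_norm_unit j : james_norm j.+1 (fun i => (i == j)%:R) <= 1 :> R.
Proof.
apply: james_norm_le => // s /james_sum_bound /le_trans; apply.
rewrite big_ord_recr /= big1 => [|i _]; first by rewrite eqxx normr1 add0r.
by rewrite ltn_eqF ?normr0.
Qed.

Lemma james_norm_restrict n a m :
  james_norm m (fun k => if (k < n)%N then a k else 0) <= james_norm n a.
Proof.
apply: le_trans (@james_norm_reparam n a m id _) => //.
rewrite (_ : (fun k => _) = (fun k => interval_sum n a (k, k.+1))) //.
by apply/funext => k; rewrite /interval_sum /= big_mkcond big_nat1.
Qed.

Lemma cauchy_schwarz_sum n a x :
  (\sum_(i < n) a i * x i) ^+ 2 <= (\sum_(i < n) a i ^+ 2) * \sum_(i < n) x i ^+ 2.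
Proof.
elim: n => [|n IH]; first by rewrite !big_ord0 mul0r expr0n.
rewrite !big_ord_recr /=.
have sq0 u : 0 <= \sum_(i < n) u i ^+ 2 :> R by rewrite sumr_ge0 // => *; exact: sqr_ge0.
move: (sq0 a) (sq0 x) IH.
move: (\sum_(i < n) a i * x i) (\sum_(i < n) a i ^+ 2) (\sum_(i < n) x i ^+ 2).
move=> S P Q P0 Q0 SPQ; set b := a n; set c := x n.
(* The cross term is controlled by the induction hypothesis [S ^+ 2 <= P * Q] and the inequality of
   arithmetic and geometric means. *)
have : `|2 * (S * (b * c))| <= P * c ^+ 2 + Q * b ^+ 2.
  have h1 : 0 <= P * c ^+ 2 by rewrite mulr_ge0 // sqr_ge0.
  have h2 : 0 <= Q * b ^+ 2 by rewrite mulr_ge0 // sqr_ge0.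
  rewrite -ler_sqr ?nnegrE ?addr_ge0 // real_normK ?num_real //.
  have := ler_wpM2r (mulr_ge0 (sqr_ge0 b) (sqr_ge0 c)) SPQ.
  have := sqr_ge0 (P * c ^+ 2 - Q * b ^+ 2); nra.
have := ler_norm (2 * (S * (b * c))); nra.
Qed.

End JamesNorm.

(** * Superposed square waves at the critical exponent 1/2 *)

Section SquareWaves.
Variable R : realType.
Implicit Types (h m n d i k l r q : nat) (a x : nat -> R).

(** Consecutive half-periods cancel, so at most one of the [q] full ones survives. The partial sums
    form a triangular wave between 0 and [h]. *)
Lemma sum_wave h q r : (0 < h)%N -> (r <= h)%N ->
  \sum_(i < q * h + r) (-1) ^+ (i %/ h) =
    (odd q)%:R * h%:R + (-1) ^+ q * r%:R :> R.
Proof.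
move=> h0; have tail q' r' : (r' <= h)%N ->
    \sum_(i < r') (-1) ^+ ((q' * h + i) %/ h) = (-1) ^+ q' * r'%:R :> R.
  move=> r'h; under eq_bigr => i _.
    rewrite divnMDl // divn_small ?(leq_trans (ltn_ord i)) // addn0; over.
  by rewrite sumr_const card_ord mulr_natr.
move=> rh; rewrite big_split_ord /= tail //; congr (_ + _).
elim: q => [|q IH]; first by rewrite mul0n big_ord0 mul0r.
rewrite mulSn addnC big_split_ord /= IH tail // -mulrDl.
by rewrite -signr_odd; case: (odd q) => /=; rewrite ?expr1 ?expr0; congr (_ * _); ring.
Qed.

Lemma sum_wave_bounds h n : (0 < h)%N ->
  0 <= (\sum_(i < n) (-1) ^+ (i %/ h) : R) <= h%:R.
Proof.
move=> h0; have rh := ltn_pmod n h0.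
rewrite (divn_eq n h) sum_wave ?(ltnW rh) // -signr_odd.
have : (n %% h)%:R <= h%:R :> R by rewrite ler_nat ltnW.
have : 0 <= (n %% h)%:R :> R by rewrite ler0n.
by case: odd; rewrite /= ?expr1 ?expr0; lra.
Qed.

Lemma wave_interval_sum h d l r : (0 < h)%N -> (l <= r)%N ->
  `|\sum_(l <= i < r) (-1) ^+ ((i + d) %/ h) : R| <= Num.min (r - l)%:R h%:R.
Proof.
move=> h0 lr; rewrite le_min; apply/andP; split.
  apply: le_trans (ler_norm_sum _ _ _) _.
  under eq_bigr do rewrite normrX normrN1 expr1n.
  by rewrite sumr_const_nat.
pose F k : R := \sum_(i < k) (-1) ^+ (i %/ h).
suff -> : \sum_(l <= i < r) (-1) ^+ ((i + d) %/ h) = F (r + d)%N - F (l + d)%N.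
  have /andP[] := sum_wave_bounds (l + d) h0.
  have /andP[] := sum_wave_bounds (r + d) h0.
  by rewrite -/(F _) -/(F _) ler_norml; lra.
rewrite -[in LHS](addnK d r) -(big_addn l (r + d) d xpredT (fun i => (-1) ^+ (i %/ h))).
rewrite /F -!(big_mkord xpredT (fun i => (-1) ^+ (i %/ h))).
by rewrite [in RHS](@big_cat_nat _ _ _ (l + d)) ?leq_add2r //= addrAC subrr add0r.
Qed.

(** A discrete Young integral: the value of the functional [sum_i a_i s_i] at the vector
    [sum_j x_j e_j]. *)
Definition partial_sum_form n a x : R :=
  \sum_(i < n) a i * \sum_(j < i.+1) x j.

(** The quarter period shift centres the triangular wave of partial sums at 0 and matches its sign
    with that of the first wave. On each half-period it then rises to [m] and falls back to 0, which
    contributes [m ^+ 2]. *)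
Lemma partial_sum_form_waves m q : (0 < m)%N ->
  partial_sum_form (q * (2 * m)) (fun i => (-1) ^+ (i %/ (2 * m)))
    (fun i => (-1) ^+ ((i + m) %/ (2 * m))) = q%:R * m%:R ^+ 2.
Proof.
move=> m0; have h0 : (0 < 2 * m)%N by rewrite muln_gt0.
pose F k : R := \sum_(i < k) (-1) ^+ (i %/ (2 * m)).
have FE i : \sum_(j < i.+1) (-1) ^+ ((j + m) %/ (2 * m)) = F (m + i.+1)%N - m%:R.
  have mh : (m <= 2 * m)%N by lia.
  have := sum_wave 0 h0 mh; rewrite mul0n add0n mul0r add0r expr0 mul1r => Fm.
  rewrite /F big_split_ord /= Fm addrAC subrr add0r.
  by apply: eq_bigr => j _; rewrite addnC.
rewrite /partial_sum_form; under eq_bigr do rewrite FE.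
elim: q => [|q IH]; first by rewrite mul0n big_ord0 mul0r.
rewrite mulSn addnC big_split_ord /= IH -[q.+1]addn1 natrD mulrDl mul1r.
congr (_ + _); rewrite (_ : 2 * m = m + m)%N ?big_split_ord /=; last lia.
have -> : \sum_(i < m) (-1) ^+ ((q * (m + m) + i) %/ (m + m)) *
    (F (m + (q * (m + m) + i).+1)%N - m%:R) = \sum_(i < m) i.+1%:R.
  apply: eq_bigr => i _; have im := ltn_ord i.
  rewrite divnMDl ?divn_small ?addn0; [|lia|lia].
  rewrite (_ : m + _ = q * (2 * m) + (m + i.+1))%N; last lia.
  rewrite /F sum_wave //; last lia.
  rewrite -signr_odd natrM natrD; case: odd => /=; ring.
have -> : \sum_(i < m) (-1) ^+ ((q * (m + m) + (m + i)) %/ (m + m)) *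
    (F (m + (q * (m + m) + (m + i)).+1)%N - m%:R) = \sum_(i < m) (m%:R - i.+1%:R).
  apply: eq_bigr => i _; have im := ltn_ord i.
  rewrite divnMDl ?divn_small ?addn0; [|lia|lia].
  rewrite (_ : m + _ = q.+1 * (2 * m) + i.+1)%N; last lia.
  rewrite /F sum_wave //; last lia.
  rewrite -signr_odd -(signr_odd _ q.+1) /= natrM; case: odd => /=; ring.
rewrite -big_split /= (eq_bigr (fun=> m%:R)) => [|i _]; last by ring.
by rewrite sumr_const card_ord expr2 mulr_natr.
Qed.

(* The term for [k] bounds the interval sums over length [d] of a square wave
   of amplitude [2^-k] and half-period [2 * 4^k]. *)
Definition wave_modulus n d : R :=
  \sum_(k < n) 2^-1 ^+ k * Num.min d%:R (2 * 4 ^ k)%N%:R.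

(** With [4 ^ p <= d < 4 ^ p.+1], the scales below [p] form an increasing geometric sum and the
    others a decreasing one. Both are of order [2 ^ p], that is, of the square root of [d]. *)
Lemma wave_modulus_le n d : wave_modulus n d ^+ 2 <= 100 * d%:R.
Proof.
have W0 : 0 <= wave_modulus n d by rewrite /wave_modulus sumr_ge0.
have [->|d0] := posnP d.
  rewrite mulr0 (_ : wave_modulus n 0 = 0) ?expr0n //.
  by rewrite /wave_modulus big1 // => k _; rewrite min_l ?mulr0.
have /andP[lo hi] := trunc_log_bounds (isT : 1 < 4)%N d0.
set p := trunc_log 4 d in lo hi.
have half_gt0 k : 0 < 2^-1 ^+ k :> R by rewrite exprn_gt0 // invr_gt0.
have halfK k : 2^-1 ^+ k * 2 ^+ k = 1 :> R by rewrite -exprMn mulVf ?expr1n.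
have four k : (4 ^ k)%:R = 2 ^+ k * 2 ^+ k :> R by rewrite natrX -exprMn -natrM.
have geom : wave_modulus n d <= if (n <= p)%N then 2 * 2 ^+ n
    else 2 * 2 ^+ p + 2 * d%:R * 2^-1 ^+ p - 2 * d%:R * 2^-1 ^+ n.
  elim: n {W0} => [|n IH]; first by rewrite /wave_modulus big_ord0 leq0n; lra.
  rewrite /wave_modulus big_ord_recr /=; move: IH; rewrite /wave_modulus.
  set m := Num.min _ _.
  have md : 2^-1 ^+ n * m <= 2^-1 ^+ n * d%:R.
    by rewrite ler_pM2l // ge_min lexx.
  have mh : 2^-1 ^+ n * m <= 2 * 2 ^+ n.
    apply: le_trans (_ : 2^-1 ^+ n * (2 * 4 ^ n)%N%:R <= _).
      by rewrite ler_pM2l // ge_min lexx orbT.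
    by rewrite natrM four mulrCA mulrA mulrA -[X in X * _]mulrA halfK mulr1.
  have [np|pn] := ltnP n p.
    by rewrite (ltnW np) exprS; lra.
  have [np|np] := leqP n p.
    have np_eq : n = p by lia.
    by rewrite np_eq exprS in md *; lra.
  by rewrite exprS; lra.
have {geom}geom : wave_modulus n d <= 2 * 2 ^+ p + 2 * d%:R * 2^-1 ^+ p.
  apply: le_trans geom _; case: leqP => [np|_].
    have : 2 ^+ n <= 2 ^+ p :> R by rewrite ler_eXn2l ?ltr1n.
    have : 0 <= d%:R * 2^-1 ^+ p :> R by rewrite mulr_ge0 // ltW.
    lra.
  have : 0 <= d%:R * 2^-1 ^+ n :> R by rewrite mulr_ge0 // ltW.
  lra.
have dlo : 2 ^+ p * 2 ^+ p <= d%:R :> R by rewrite -four ler_nat.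
have dhi : d%:R <= 4 * (2 ^+ p * 2 ^+ p) :> R.
  by rewrite -four -natrM -expnS ler_nat ltnW.
(* Here 10 is 2 + 8, since [d] is at most [4 * 4 ^ p]; its square is the constant 100. *)
have : wave_modulus n d <= 10 * 2 ^+ p.
  apply: le_trans geom _.
  have : d%:R * 2^-1 ^+ p <= 4 * (2 ^+ p * 2 ^+ p) * 2^-1 ^+ p :> R.
    by rewrite ler_pM2r.
  have -> : 4 * (2 ^+ p * 2 ^+ p) * 2^-1 ^+ p = 4 * 2 ^+ p :> R.
    have := halfK p; move: (2^-1 ^+ p) (2 ^+ p) => h P hP.
    by transitivity (4 * P * (h * P)); [ring | rewrite hP mulr1].
  lra.
have : 0 <= 2 ^+ p :> R by rewrite exprn_ge0.
nra.
Qed.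

(** By [wave_modulus_le], the partial sums are 1/2-Hölder with constant 10, uniformly in [n]. The
    finer modulus is kept so that one more scale can be added in an induction. *)
Definition wave_bounded n a := forall l r, (l <= r)%N ->
  `|\sum_(l <= i < r) a i| <= wave_modulus n (r - l).

Lemma wave_boundedS n a (w : nat -> R) (c : R) : `|c| = 2^-1 ^+ n ->
    wave_bounded n a ->
    (forall l r, (l <= r)%N ->
       `|\sum_(l <= i < r) w i| <= Num.min (r - l)%:R (2 * 4 ^ n)%N%:R) ->
  wave_bounded n.+1 (fun i => a i + c * w i).
Proof.
move=> cE aB wB l r lr; rewrite /wave_modulus big_ord_recr big_split /=.
apply: le_trans (ler_normD _ _) (lerD (aB _ _ lr) _).
by rewrite -mulr_sumr normrM cE ler_wpM2l ?wB // -cE.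
Qed.

(* At each scale the sign [eps] is chosen so that the cross terms of the
   bilinear form do not decrease it. *)
Lemma oscillating_pair n N : (4 ^ n %| N)%N ->
  exists a x, [/\ wave_bounded n a, wave_bounded n x &
    n%:R * (N%:R / 2) <= partial_sum_form N a x].
Proof.
elim: n => [|n IH] nN.
  exists (fun=> 0), (fun=> 0); split.
  - by move=> l r _; rewrite /wave_modulus big1 // normr0 big_ord0.
  - by move=> l r _; rewrite /wave_modulus big1 // normr0 big_ord0.
  - by rewrite mul0r /partial_sum_form big1 // => i _; rewrite mul0r.
have [a [x [aB xB ax]]] := IH (dvdn_trans (dvdn_exp2l 4 (leqnSn n)) nN).
set m := (4 ^ n)%N; have m0 : (0 < m)%N by rewrite expn_gt0.
pose u i : R := (-1) ^+ (i %/ (2 * m)).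
pose v i : R := (-1) ^+ ((i + m) %/ (2 * m)).
have uB l r : (l <= r)%N ->
    `|\sum_(l <= i < r) u i| <= Num.min (r - l)%:R (2 * m)%N%:R.
  have h0 : (0 < 2 * m)%N by rewrite muln_gt0.
  move=> lr; have := wave_interval_sum 0 h0 lr.
  by under eq_bigr do rewrite addn0.
have vB l r : (l <= r)%N ->
    `|\sum_(l <= i < r) v i| <= Num.min (r - l)%:R (2 * m)%N%:R.
  by move=> lr; apply: wave_interval_sum; rewrite ?muln_gt0.
have uv : partial_sum_form N u v = N%:R / 2 * m%:R.
  have /dvdnP[q ->] : (2 * m %| N)%N.
    by apply: dvdn_trans nN; rewrite expnS dvdn_mul.
  by rewrite partial_sum_form_waves // !natrM; field.
pose D := partial_sum_form N a v + partial_sum_form N u x.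
pose eps : R := if 0 <= D then 1 else -1.
have epsE : eps * eps = 1 by rewrite /eps; case: ifP => _; ring.
have epsD : 0 <= eps * D.
  by rewrite /eps; case: (leP 0 D) => D0; rewrite ?mul1r // mulN1r oppr_ge0 ltW.
have half_gt0 k : 0 < 2^-1 ^+ k :> R by rewrite exprn_gt0 // invr_gt0.
pose c := eps * 2^-1 ^+ n.
have cE : `|c| = 2^-1 ^+ n.
  rewrite normrM (gtr0_norm (half_gt0 n)) /eps.
  by case: ifP => _; rewrite ?normrN1 ?normr1 mul1r.
exists (fun i => a i + c * u i), (fun i => x i + c * v i); split.
- exact: wave_boundedS.
- exact: wave_boundedS.
have -> : partial_sum_form N (fun i => a i + c * u i) (fun i => x i + c * v i) =
    partial_sum_form N a x + c * D + c ^+ 2 * partial_sum_form N u v.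
  rewrite /D /partial_sum_form mulrDr !mulr_sumr -!big_split /=.
  apply: eq_bigr => i _; rewrite big_split /= -mulr_sumr; ring.
rewrite uv.
(* The squared amplitude [4^-n] cancels [m], so every scale contributes the same amount. *)
have -> : c ^+ 2 * (N%:R / 2 * m%:R) = N%:R / 2.
  rewrite /c /m natrX (_ : 4%:R = 2 * 2 :> R); last by ring.
  rewrite (_ : _ ^+ 2 = eps * eps * (2^-1 ^+ n * 2^-1 ^+ n)); last by ring.
  have halfK : 2^-1 ^+ n * 2 ^+ n = 1 :> R by rewrite -exprMn mulVf ?expr1n.
  rewrite epsE mul1r exprMn; move: (2^-1 ^+ n) (2 ^+ n) halfK => y z yz.
  by transitivity (N%:R / 2 * ((y * z) * (y * z))); [ring | rewrite yz !mulr1].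
have : 0 <= c * D by rewrite /c mulrAC mulr_ge0 // ltW.
rewrite -natr1; lra.
Qed.

(** Squared interval sums are at most 100 times the lengths, and the lengths of disjoint intervals
    truncated at [N] add up to at most [N]. *)
Lemma james_norm_wave_bounded n N a :
  wave_bounded n a -> james_norm N a ^+ 2 <= 100 * N%:R.
Proof.
move=> aB; have N0 : 0 <= 100 * N%:R :> R by rewrite mulr_ge0.
suff : james_norm N a <= Num.sqrt (100 * N%:R).
  by rewrite -ler_sqr ?nnegrE ?james_norm_ge0 ?sqrtr_ge0 // sqr_sqrtr.
apply: james_norm_le => [|s ss]; first exact: sqrtr_ge0.
rewrite sqr_sqrtr //.
have pre k : interval_sum N a (0, k)%N = \sum_(0 <= i < minn k N) a i.
  elim: k => [|k IH]; first by rewrite min0n /interval_sum !big_nil.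
  rewrite interval_sumS IH; have [kN|Nk] := ltnP k N.
    by rewrite (minn_idPl kN) big_nat_recr.
  by rewrite addr0 (minn_idPr (leqW Nk)).
pose G k : R := 100 * (minn k N)%:R.
have GM : {homo G : i j / (i <= j)%N >-> i <= j}.
  by move=> i j ij; rewrite /G ler_pM2l // ler_nat; lia.
have GB k : G k <= 100 * N%:R by rewrite /G ler_pM2l // ler_nat geq_minr.
apply: le_trans (_ : \sum_(E <- s) (G E.2 - G E.1) <= _); last first.
  have := sum_increments_le GM GB (successiveW ss).
  by rewrite [G 0%N]/G min0n mulr0 subr0.
rewrite big_seq [leRHS]big_seq; apply: ler_sum => -[l r] Es /=.
have lr : (l <= r)%N by case/andP: (successiveW ss) => /allP /(_ _ Es).
have lrN : (minn l N <= minn r N)%N by lia.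
rewrite interval_sum_prefix // !pre (@big_cat_nat _ _ _ (minn l N)) //=.
rewrite addrAC subrr add0r -mulrBr -natrB //.
apply: le_trans (wave_modulus_le n _).
by rewrite -real_normK ?num_real // lerXn2r ?nnegrE ?aB // (le_trans _ (aB _ _ lrN)).
Qed.

End SquareWaves.

(** * Evaluation of functionals and of their combinations *)

Section DualCombinations.
Variables (R : realType) (X : normedModType R).
Implicit Types (f g : dual X) (a : nat -> R).

Lemma dual_lin_combE f (y : nat -> X) n a :
  f (lin_comb y n a) = \sum_(i < n) a i * f (y i).
Proof.
have /dual_predP[fl _] := dual_funP f.
pose L := GRing.isLinear.Build R X R^o *:%R f fl.
pose F : {linear X -> R^o} := HB.pack (f : X -> R^o) L.
have -> : f (lin_comb y n a) = F (lin_comb y n a) by [].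
by rewrite linear_sum; apply: eq_bigr => i _; rewrite linearZ.
Qed.

Lemma sum_dualE (I : Type) (r : seq I) (a : I -> R) (s : I -> dual X) z :
  (\sum_(i <- r) a i *: s i : dual X) z = \sum_(i <- r) a i * s i z.
Proof.
by elim: r => [|i r IH]; [rewrite !big_nil | rewrite !big_cons -IH].
Qed.

Lemma lin_comb_dualE (s : nat -> dual X) n a z :
  (lin_comb s n a) z = \sum_(i < n) a i * s i z.
Proof. exact: sum_dualE. Qed.

Lemma dual_norm_bound f z : `|f z| <= `|f| * `|z|.
Proof. exact: ler_dual_norm. Qed.

End DualCombinations.

(** * Approximation and convexity in normed spaces *)

Section NormedSpaces.
Variables (R : realType) (X : normedModType R).

Lemma closed_span_approx (y : nat -> X) z (eps : R) : 0 < eps ->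
  closed_span y z -> exists n a, `|z - lin_comb y n a| < eps.
Proof.
move=> eps0 /(_ _ (nbhsx_ballx z eps eps0))[_ [[n [a ->]]]].
by rewrite -ball_normE; exists n, a.
Qed.

(** By convexity of the norm, each [w k] may be replaced by single vectors [y i] with [i] in [F k],
    one [k] at a time. The vector [v] absorbs the terms split off in the induction. *)
Lemma norm_lin_comb_convex_le (y w : nat -> X) (F : nat -> seq nat) (c : nat -> R)
    n a v (M : R) :
    (forall k i, i \in F k -> 0 <= c i) -> (forall k, \sum_(i <- F k) c i = 1) ->
    (forall k, w k = \sum_(i <- F k) c i *: y i) ->
    (forall phi, (forall k, (k < n)%N -> phi k \in F k) ->
      `|v + lin_comb (y \o phi) n a| <= M) ->
  `|v + lin_comb w n a| <= M.
Proof.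
move=> c0 c1 wE; elim: n v => [|n IH] v H; first by
  rewrite /lin_comb big_ord0; have := H id; rewrite /lin_comb big_ord0; apply.
rewrite /lin_comb big_ord_recr /= addrA addrAC; apply: IH => phi Fphi.
rewrite wE scaler_sumr addrAC.
set u := v + _.
have -> : u + \sum_(i <- F n) a n *: (c i *: y i) =
    \sum_(i <- F n) c i *: (u + a n *: y i).
  rewrite -[u in LHS]scale1r -(c1 n) scaler_suml -big_split /=.
  by apply: eq_bigr => i _; rewrite [RHS]scalerDr !scalerA mulrC.
apply: le_trans (ler_norm_sum _ _ _) _.
rewrite -[M]mul1r -(c1 n) mulr_suml big_seq [leRHS]big_seq.
apply: ler_sum => i Fi; have ci := c0 _ _ Fi.
rewrite normrZ ger0_norm // ler_wpM2l //.
pose phi' k := if k == n then i else phi k.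
have phi'n : phi' n = i by rewrite /phi' eqxx.
have := H phi'; rewrite /lin_comb big_ord_recr /= phi'n addrA.
rewrite (eq_bigr (fun k : 'I_n => a k *: y (phi k))) => [|k _]; last first.
  by rewrite /phi' (ltn_eqF (ltn_ord k)).
apply=> k; rewrite ltnS leq_eqVlt /phi'.
by case: eqP => [-> //|_ /= kn]; exact: Fphi.
Qed.

End NormedSpaces.

(** * The sequence [s] in the dual of James space *)

Section JamesDual.
Variables (R : realType) (J : completeNormedModType R) (e : nat -> J).
Hypothesis hJ : james_space e.
Variables (estar s : nat -> dual J).
Hypothesis hestar : biorthogonal e estar.
Hypothesis hs : forall n, s n = \sum_(i < n.+1) estar i.
Implicit Types (f g : dual J) (a x : nat -> R).

Lemma s_lin_comb k n x : s k (lin_comb e n x) = interval_sum n x (0, k.+1)%N.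
Proof.
rewrite dual_lin_combE interval_sum_widen [RHS]big_mkcond; apply: eq_bigr => i _.
have -> : s k (e i) = (i < k.+1)%:R.
  rewrite hs (eq_bigr (fun j : 'I_k.+1 => 1 *: estar j)) => [|j _]; last by rewrite scale1r.
  rewrite sum_dualE (eq_bigr (fun j : 'I_k.+1 => (val i == j)%:R)) => [|j _].
    have [ik|ki] := ltnP i k.+1.
      rewrite (bigD1 (Ordinal ik)) //= eqxx big1 ?addr0 // => j.
      by rewrite -val_eqE /= eq_sym => /negbTE ->.
    by rewrite big1 // => j _; rewrite gtn_eqF // (leq_trans (ltn_ord j)).
  by rewrite mul1r hestar eq_sym.
by case: ifP => _; rewrite ?mulr1 ?mulr0.
Qed.

Lemma e_lin_comb i : e i = lin_comb e i.+1 (fun j => (j == i)%:R).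
Proof.
rewrite /lin_comb big_ord_recr /= eqxx scale1r big1 ?add0r // => j _.
by rewrite (ltn_eqF (ltn_ord j)) scale0r.
Qed.

Lemma norm_lin_comb_e n x : `|lin_comb e n x| = james_norm n x.
Proof. by case: hJ => + _; apply. Qed.

Lemma norm_e i : `|e i| <= 1.
Proof. by rewrite e_lin_comb norm_lin_comb_e james_norm_unit. Qed.

Lemma dual_lin_comb_le f n x : `|f (lin_comb e n x)| <= `|f| * james_norm n x.
Proof. by rewrite -norm_lin_comb_e; exact: dual_norm_bound. Qed.

Lemma dual_norm_le_span f (M : R) : 0 <= M ->
  (forall n x, `|f (lin_comb e n x)| <= M * james_norm n x) -> `|f| <= M.
Proof.
move=> M0 H; apply: ge_sup; first by case: (dual_norm_has_sup f).
move=> _ [z /= z1 <-].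
have zM : `|f z| <= M * `|z|.
  apply/ler_addgt0Pr => eps eps0.
  (* The approximation error enters twice, with factors [|f|] and [M]; the added 1 keeps the
     denominator positive. *)
  pose d := eps / (M + `|f| + 1).
  have den0 : 0 < M + `|f| + 1 by rewrite ltr_wpDl ?addr_ge0.
  have d0 : 0 < d by rewrite divr_gt0.
  have [n [x zx]] : exists n x, `|z - lin_comb e n x| < d.
    by apply: closed_span_approx => //; case: hJ => _ ->.
  set y := lin_comb e n x in zx *.
  have fB : f z = f (z - y) + f y.
    have := dual_lin_combE f (fun i => if i == 0%N then z - y else y) 2 (fun=> 1).
    by rewrite /lin_comb !big_ord_recr !big_ord0 /= !add0r !scale1r !mul1r subrK.
  have fy : `|f y| <= M * `|y| by rewrite /y norm_lin_comb_e.
  have yz : `|y| <= `|z| + d.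
    have := ler_normD (y - z) z; rewrite subrK distrC; lra.
  have fzy := dual_norm_bound f (z - y).
  have eE : eps = d * (M + `|f| + 1) by rewrite /d divfK // gt_eqF.
  rewrite fB (le_trans (ler_normD _ _)) // eE.
  have : `|f| * `|z - y| <= `|f| * d by rewrite ler_wpM2l // ltW.
  have : M * `|y| <= M * (`|z| + d) by rewrite ler_wpM2l.
  lra.
by rewrite (le_trans zM) // -[leRHS]mulr1 ler_wpM2l.
Qed.

(** The common tool for both inequalities on convex blocks: reparametrisation contracts the James
    norm, and [psi] may depend on the vector. *)
Lemma dual_norm_le_reparam f g :
    (forall n x, exists m (psi : nat -> nat),
      {homo psi : i j / (i <= j)%N} /\ g (lin_comb e n x) =
        f (lin_comb e m (fun k => interval_sum n x (psi k, psi k.+1)))) ->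
  `|g| <= `|f|.
Proof.
move=> H; apply: dual_norm_le_span => // n x.
have [m [psi [psiM ->]]] := H n x.
by apply: le_trans (dual_lin_comb_le _ _ _) _; rewrite ler_wpM2l ?james_norm_reparam.
Qed.

(** As [s k] is 1 at [e j] for [j <= k] and 0 otherwise, evaluation at [e i - e i.+1] is
    biorthogonal to [s]. *)
Definition coef f i := f (e i) - f (e i.+1).

Lemma coefB f g i : coef (f - g) i = coef f i - coef g i.
Proof.
have sub z : (f - g) z = f z - g z by [].
by rewrite /coef !sub; ring.
Qed.

Lemma coef_le f i : `|coef f i| <= 2 * `|f|.
Proof.
have H j : `|f (e j)| <= `|f|.
  apply: le_trans (dual_norm_bound f (e j)) _.
  by rewrite -[leRHS]mulr1 ler_wpM2l ?norm_e.
by rewrite /coef (le_trans (ler_normB _ _)) // mulr2n mulrDl !mul1r lerD ?H.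
Qed.

Lemma coef_lin_comb n a i :
  coef (lin_comb s n a) i = if (i < n)%N then a i else 0.
Proof.
rewrite /coef !lin_comb_dualE -sumrB.
rewrite (eq_bigr (fun k : 'I_n => if val k == i then a k else 0)) => [|k _].
  rewrite -big_mkcond /=; case: ltnP => [lt_in|ni].
    by rewrite (big_pred1 (Ordinal lt_in)).
  by rewrite big_pred0 // => k; rewrite ltn_eqF // (leq_trans (ltn_ord k)).
have sE j : s k (e j) = (j <= k)%:R.
  rewrite e_lin_comb s_lin_comb interval_sum_widen big_mkcond big_ord_recr /=.
  rewrite eqxx ltnS big1 ?add0r; first by case: leqP.
  by move=> l _; rewrite (ltn_eqF (ltn_ord l)) if_same.
by rewrite !sE -mulrBr; case: ltngtP => _; rewrite ?subrr ?mulr0 ?subr0 ?mulr1.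
Qed.

Lemma lin_comb_coef_id n a N : (n <= N)%N ->
  lin_comb s N (coef (lin_comb s n a)) = lin_comb s n a.
Proof.
move: (coef _) (coef_lin_comb n a) => b bE nN.
rewrite /lin_comb (big_ord_widen _ (fun i => a i *: s i) nN).
rewrite [RHS]big_mkcond /=; apply: eq_bigr => i _.
by rewrite bE; case: ifP; rewrite ?scale0r.
Qed.

(* Summation by parts: the partial sum operator is the adjoint of
   [e_i |-> e_i - e_N] for [i < N] and [e_i |-> 0] for [i >= N]. *)
Lemma norm_lin_comb_coef f N : `|lin_comb s N (coef f)| <= 2 * `|f|.
Proof.
apply: dual_norm_le_span => [|n x]; first by rewrite mulr_ge0.
rewrite lin_comb_dualE.
pose y k := if (k < n)%N then x k else 0.
have -> : \sum_(i < N) coef f i * s i (lin_comb e n x) =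
    f (lin_comb e N y) - interval_sum n x (0, N)%N * f (e N).
  rewrite dual_lin_combE; elim: N => [|N IH].
    by rewrite !big_ord0 /interval_sum big_nil mul0r subrr.
  by rewrite !big_ord_recr /= IH s_lin_comb interval_sumS -/(y N) /coef; ring.
have fy : `|f (lin_comb e N y)| <= `|f| * james_norm n x.
  apply: le_trans (dual_lin_comb_le _ _ _) _.
  by rewrite ler_wpM2l ?james_norm_restrict.
rewrite (le_trans (ler_normB _ _)) // -mulrA mulr2n mulrDl !mul1r lerD // normrM.
rewrite [leRHS]mulrC ler_pM // ?interval_sum_le_james_norm //.
apply: le_trans (dual_norm_bound f (e N)) _.
by rewrite -[leRHS]mulr1 ler_wpM2l ?norm_e.
Qed.

(** The partial sum operators are bounded by 2 and eventually fix every finite combination, so they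
    converge on the closure. Uniqueness follows from continuity of the coefficients. *)
Lemma schauder_basis_s : schauder_basis s (closed_span s).
Proof.
split=> [i|f fY].
  apply: subset_closure; exists i.+1, (fun j => (j == i)%:R).
  rewrite /lin_comb big_ord_recr /= eqxx scale1r big1 ?add0r // => j _.
  by rewrite (ltn_eqF (ltn_ord j)) scale0r.
exists (coef f); split.
  apply/cvgrPdist_lt => eps eps0.
  (* The error counts once for [f - g] and twice for its partial sum. *)
  have [n [a fa]] : exists n a, `|f - lin_comb s n a| < eps / 3.
    by apply: closed_span_approx => //; rewrite divr_gt0.
  near=> N; have nN : (n <= N)%N by near: N; exists n.
  set g := lin_comb s n a in fa.
  have -> : f - lin_comb s N (coef f) = (f - g) - lin_comb s N (coef (f - g)).
    rewrite [in RHS]/lin_comb (eq_bigr (fun i : 'I_N => coef f i *: s i - coef g i *: s i)).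
      rewrite sumrB -!/(lin_comb s N _) [X in _ - (_ - X)]lin_comb_coef_id // -/g.
      by rewrite opprB addrA subrK.
    by move=> i _; rewrite coefB scalerBl.
  apply: le_lt_trans (ler_normB _ _) _.
  have := norm_lin_comb_coef (f - g) N; lra.
move=> b bf; apply/funext => i; apply/eqP; rewrite -subr_eq0 -normr_le0.
apply/ler_addgt0Pr => eps eps0; rewrite add0r.
move/cvgrPdist_lt: bf => /(_ (eps / 2)); rewrite divr_gt0 // => /(_ isT)[m _ mP].
have := mP (maxn m i.+1) (leq_maxl _ _).
have := coef_le (f - lin_comb s (maxn m i.+1) b) i.
rewrite coefB coef_lin_comb leq_maxr; lra.
Unshelve. all: by end_near.
Qed.

(** Sampling the partial sums at the indices [phi k] is a reparametrisation. The value [psi 0 = 0]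
    keeps the start at 0, and the successor appears because [s k] includes index [k]. *)
Lemma norm_lin_comb_subseq (phi : nat -> nat) n a :
    (forall k, phi k < phi k.+1)%N ->
  `|lin_comb (s \o phi) n a| <= `|lin_comb s n a|.
Proof.
move=> phiM; apply: dual_norm_le_reparam => m x.
pose psi k := if k is k'.+1 then (phi k').+1 else 0%N.
have psiM : {homo psi : i j / (i <= j)%N}.
  by apply: homo_leq => [i|j i k|[|i]] //=; [exact: leq_trans | exact: leqW].
exists n, psi; split=> //; rewrite !lin_comb_dualE; apply: eq_bigr => k _.
by rewrite /= !s_lin_comb interval_sum_reparam // min0n (minn_idPl (ltn_ord k)).
Qed.

Lemma norm_lin_comb_convex_block w n a :
  convex_block s w -> `|lin_comb w n a| = `|lin_comb s n a|.
Proof.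
move=> [F [c [Flt c0 c1 wE]]].
have /choice[phi Fphi] k : exists i, i \in F k.
  have [F0|[i Fi]] := fset_0Vmem (F k); last by exists i.
  by have /esym/eqP := c1 k; rewrite F0 big_seq_fset0 oner_eq0.
have Fltd d k i j : i \in F k -> j \in F (k + d.+1)%N -> (i < j)%N.
  elim: d j => [|d IH] j Fi; first by rewrite addn1; exact: Flt.
  by rewrite addnS => /(Flt _ _ _ (Fphi _)); apply: ltn_trans; exact: IH.
have {}Fltd k l i j : (k < l)%N -> i \in F k -> j \in F l -> (i < j)%N.
  by move=> kl; rewrite -(subnKC kl) addSnnS; exact: Fltd.
apply/le_anti/andP; split.
  rewrite -[lin_comb w n a]add0r.
  apply: (@norm_lin_comb_convex_le _ _ s w (fun k => F k) c) => // phi' Fphi'.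
  (* Only the first [n] choices matter; [phi] prolongs them to a strictly increasing sequence. *)
  pose theta k := if (k < n)%N then phi' k else phi k.
  rewrite add0r (_ : lin_comb _ n a = lin_comb (s \o theta) n a).
    by apply: norm_lin_comb_subseq => k; apply: (Flt k); rewrite /theta;
      case: ifP => // kn; apply: Fphi'.
  by apply: eq_bigr => k _; rewrite /theta /= ltn_ord.
have phi_ge k i : i \in F k -> (k <= i)%N.
  elim: k i => // k IH i Fi; apply: leq_ltn_trans (IH _ (Fphi k)) _.
  exact: Flt Fi.
(* The number of blocks with an element below [i]; blocks from [i] on have none. Right after any
   element of [F k] it is [k.+1], so partial sums reparametrised by [q] are constant along each
   block. *)
pose q i := (\sum_(k < i) has (fun j => j < i) (F k))%N.
have q0 : q 0%N = 0%N by rewrite /q big_ord0.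
have qM : {homo q : i j / (i <= j)%N}.
  apply: homo_leq => // [i j k|i]; first exact: leq_trans.
  rewrite /q big_ord_recr /=; apply: leq_trans (leq_addr _ _).
  apply: leq_sum => k _.
  have : has (fun j => j < i)%N (F k) ==> has (fun j => j < i.+1)%N (F k).
    by apply/implyP; apply: sub_has => j; exact: leqW.
  by do 2 case: has.
have qF k i : i \in F k -> q i.+1 = k.+1.
  move=> Fi; rewrite /q (eq_bigr (fun l : 'I_i.+1 => if (l < k.+1)%N then 1 else 0)%N).
    have ki : (k.+1 <= i.+1)%N by rewrite ltnS; exact: phi_ge Fi.
    by rewrite -big_mkcond (big_ord_narrow ki) sum1_card card_ord.
  move=> l _; rewrite ltnS; case: ltngtP => [lk|kl|lk].
  - suff -> : has (fun j => j < i.+1)%N (F l) by [].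
    by apply/hasP; exists (phi l) => //; rewrite ltnS ltnW // (Fltd l k).
  - suff /negbTE-> : ~~ has (fun j => j < i.+1)%N (F l) by [].
    by apply/hasPn => j Fj; rewrite -leqNgt; exact: Fltd kl Fi Fj.
  - suff -> : has (fun j => j < i.+1)%N (F l) by [].
    by apply/hasP; exists i => //; rewrite lk.
apply: dual_norm_le_reparam => m y.
(* A length beyond the first [n] blocks, so that the cut-off does not affect them. *)
pose M := (\max_(k < n) \max_(i <- F k) i.+1)%N.
have FM k i : (k < n)%N -> i \in F k -> (i < M)%N.
  move=> kn Fi; apply: leq_trans (leq_bigmax (Ordinal kn)) => /=.
  exact: (@leq_bigmax_seq _ _ xpredT (fun i => i.+1)).
exists M, q; split=> //; rewrite !lin_comb_dualE; apply: eq_bigr => k _.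
congr (_ * _); rewrite wE sum_dualE -[LHS]mul1r -(c1 k) mulr_suml.
rewrite big_seq [RHS]big_seq; apply: eq_bigr => i Fi.
rewrite !s_lin_comb interval_sum_reparam // min0n q0.
by rewrite (minn_idPl (FM _ _ (ltn_ord k) Fi)) (qF k).
Qed.

Lemma equivalent_convex_block w : convex_block s w ->
  equivalent (seq_norm s) (seq_norm w).
Proof.
move=> sw; exists 1, 1; split=> // n a.
by rewrite !mul1r /seq_norm norm_lin_comb_convex_block.
Qed.

Definition alternating (b : nat -> R) i := if odd i then - b i./2 else b i./2.

Lemma norm_alternating n b :
  seq_norm s n.*2 (alternating b) <= Num.sqrt (\sum_(k < n) b k ^+ 2).
Proof.
have b0 : 0 <= \sum_(k < n) b k ^+ 2 by rewrite sumr_ge0 // => k _; exact: sqr_ge0.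
apply: dual_norm_le_span => [|m x]; first exact: sqrtr_ge0.
(* The difference [s_2k - s_(2k+1)] is minus the coordinate at [2k+1]. These singletons are
   successive, so Cauchy-Schwarz and the James norm give the l_2 bound. *)
pose E k := (k.*2.+1, k.*2.+2).
have -> : (lin_comb s n.*2 (alternating b)) (lin_comb e m x) =
    - \sum_(k < n) b k * interval_sum m x (E k).
  rewrite lin_comb_dualE; elim: n {b0} => [|n IH]; first by rewrite !big_ord0 oppr0.
  rewrite doubleS !big_ord_recr /= IH !s_lin_comb /alternating /= odd_double /=.
  by rewrite uphalf_double doubleK /E (@interval_sum_prefix _ _ _ n.*2.+1) //; ring.
rewrite normrN -ler_sqr ?nnegrE ?mulr_ge0 ?sqrtr_ge0 ?james_norm_ge0 //.
rewrite real_normK ?num_real // exprMn sqr_sqrtr //.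
apply: le_trans (cauchy_schwarz_sum n b (fun k => interval_sum m x (E k))) _; rewrite ler_wpM2l //.
have := @sum_le_james_norm _ m x [seq E k | k <- iota 0 n].
rewrite big_map -[n in iota 0 n]subn0 big_mkord; apply.
rewrite /weakly_successive all_map sorted_map; apply/andP; split.
  by apply/allP => k _ /=; rewrite /E /=.
by apply: sub_sorted (iota_ltn_sorted 0 _) => k l /=; rewrite /E /=; lia.
Qed.

End JamesDual.

(** * Comparison of jamesifications with l_2 and James space *)

Section Jamesification.
Variables (R : realType) (X : normedModType R) (x : nat -> X).
Implicit Types (n : nat) (a b : nat -> R).

(** Each interval is nonempty. Hence only the first [n] intervals can meet a vector of length [n],
    which bounds the supremum in [jamesification_norm]. *)
Lemma successive_nth_ge s k : successive_intervals s -> (k < size s)%N ->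
  (k <= (nth (0, 0) s k).1)%N.
Proof.
case/andP => sp ss; suff H p t i : all (fun E => E.1 < E.2)%N t ->
    path (fun E E' => E.2 <= E'.1)%N p t -> (i < size t)%N ->
    (p.2 + i <= (nth (0, 0) t i).1)%N.
  by move=> ks; apply: (H (0, 0)%N) => //; case: {H sp ks} s ss.
elim: t p i => [|E t IH] p [|i] //=; first by rewrite addn0 => _ /andP[].
move=> /andP[E12 tp] /andP[pE tE] it.
by have := IH E i tp tE it; lia.
Qed.

Lemma jamesification_norm_has_sup n a :
  has_sup [set seq_norm x (size s) (fun k => interval_sum n a (nth (0, 0)%N s k))
          | s in [set s | successive_intervals s]].
Proof.
split; first by exists (seq_norm x 0 (fun k => interval_sum n a (nth (0, 0) [::] k))%N), [::].
exists (james_norm n a * \sum_(k < n) `|x k|) => _ [s ss <-].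
pose B k := if (k < n)%N then james_norm n a * `|x k| else 0.
have B0 k : 0 <= B k by rewrite /B; case: ifP => // _; rewrite mulr_ge0 ?james_norm_ge0.
apply: le_trans (_ : \sum_(k < size s) B k <= _).
  apply: le_trans (ler_norm_sum _ _ _) _; apply: ler_sum => k _; rewrite normrZ.
  have := successive_nth_ge ss (ltn_ord k).
  have : all (fun E => E.1 < E.2)%N s by case/andP: ss.
  move=> /(all_nthP (0, 0)%N) /(_ _ (ltn_ord k)).
  case: (nth _ s k) => l r /= lr kl; rewrite /B; case: ltnP => [kn|nk].
    by rewrite ler_wpM2r ?interval_sum_le_james_norm // ltnW.
  rewrite /interval_sum big_nat_cond big1 ?normr0 ?mul0r // => i /=.
  by move=> /andP[/andP[li _] lt_in]; lia.
have [sn|ns] := leqP (size s) n.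
  rewrite mulr_sumr (big_ord_widen _ B sn) big_mkcond.
  apply: ler_sum => k _; have := B0 k; rewrite /B ltn_ord.
  by case: ifP.
rewrite mulr_sumr (eq_bigr (fun k : 'I_n => B k)) => [|k _]; last by rewrite /B ltn_ord.
rewrite (big_ord_widen _ B (ltnW ns)) [leRHS]big_mkcond.
by apply: ler_sum => k _; rewrite /B; case: ifP.
Qed.

Lemma jamesification_norm_alternating n b :
  seq_norm x n b <= jamesification_norm x n.*2 (alternating b).
Proof.
apply: sup_upper_bound; first exact: jamesification_norm_has_sup.
(* The even singletons recover [b]; the odd entries fall into the gaps. *)
pose E k := (k.*2, k.*2.+1).
exists [seq E k | k <- iota 0 n].
  rewrite /= /successive_intervals all_map sorted_map; apply/andP; split.
    by apply/allP => k _ /=; rewrite /E /=.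
  by apply: sub_sorted (iota_ltn_sorted 0 _) => k l /=; rewrite /E /=; lia.
rewrite size_map size_iota /seq_norm; congr (`|_|); apply: eq_bigr => k _.
have kn := ltn_ord k; congr (_ *: _).
rewrite (nth_map 0%N) ?size_iota // nth_iota // add0n /interval_sum /=.
rewrite big_mkcond big_nat1 ltn_double kn /alternating odd_double doubleK //.
Qed.

(** The jamesification of the l_2 basis is the basis of James space, so domination by l_2 passes to
    domination by the James norm. *)
Lemma jamesification_norm_le (C : R) n a : 0 <= C ->
    (forall m b, seq_norm x m b <= C * Num.sqrt (\sum_(k < m) b k ^+ 2)) ->
  jamesification_norm x n a <= C * james_norm n a.
Proof.
move=> C0 H; apply: ge_sup; first by case: (jamesification_norm_has_sup n a).
move=> _ [s ss <-]; apply: le_trans (H _ _) _; rewrite ler_wpM2l //.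
apply: sup_upper_bound; first exact: james_norm_has_sup.
by exists s => //; rewrite (big_nth (0, 0)%N) big_mkord.
Qed.

End Jamesification.

(** * Convex block homogeneity and the contradiction with a jamesification *)

Theorem proposition13p3 (R : realType)
    (J : completeNormedModType R) (e : nat -> J) (hJ : james_space e)
    (estar : nat -> dual J) (hestar : biorthogonal e estar)
    (s : nat -> dual J) (hs : forall n, s n = \sum_(i < n.+1) estar i)
    (Y : set (dual J)) (hY : Y = closed_span s) :
  [/\ schauder_basis s Y,
      convex_block_homogeneous s &
      forall (X : completeNormedModType R) (x : nat -> X), subsymmetric x ->
        ~ equivalent (seq_norm s) (jamesification_norm x)].
Proof.
have basis := schauder_basis_s hJ hestar hs.
split; first by rewrite hY.
  by split=> // w; exact: (equivalent_convex_block hJ hestar hs).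
move=> X x _ [A [B [A0 B0 AB]]].
have l2 m b : seq_norm x m b <= A^-1 * Num.sqrt (\sum_(k < m) b k ^+ 2).
  rewrite ler_pdivlMl //; apply: le_trans (norm_alternating hJ hestar hs m b).
  have [+ _] := AB m.*2 (alternating b); apply: le_trans.
  by rewrite ler_pM2l // jamesification_norm_alternating.
pose K := B * A^-1.
have K0 : 0 < K by rewrite divr_gt0.
have sK n a : seq_norm s n a <= K * james_norm n a.
  have [_ /le_trans] := AB n a; apply; rewrite -mulrA ler_pM2l //.
  by apply: jamesification_norm_le; rewrite ?invr_ge0 ?ltW.
(* The form is at least [n * N / 2] and at most [100 * K * N], which forces [n <= 200 * K]. *)
have [n nK] : exists n : nat, 200 * K < n%:R.
  exists (Num.bound (200 * K)); apply: archi_boundP.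
  by rewrite mulr_ge0 // ltW.
pose N := (4 ^ n)%N; have N0 : 0 < N%:R :> R by rewrite ltr0n expn_gt0.
have [a [y [aB yB ay]]] := oscillating_pair R (dvdnn N).
have aN := james_norm_wave_bounded N aB; have yN := james_norm_wave_bounded N yB.
have formE : partial_sum_form N a y = (lin_comb s N a) (lin_comb e N y).
  rewrite lin_comb_dualE; apply: eq_bigr => i _; congr (_ * _).
  rewrite (s_lin_comb hestar hs) /interval_sum big_mkord; apply: eq_bigl => j.
  by rewrite (leq_ltn_trans _ (ltn_ord i)) // -ltnS.
have formK : partial_sum_form N a y <= K * james_norm N a * james_norm N y.
  rewrite formE; apply: le_trans (ler_norm _) _.
  apply: le_trans (dual_lin_comb_le hJ _ _ _) _.
  by rewrite ler_wpM2r ?james_norm_ge0 // sK.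
have prod : james_norm N a * james_norm N y <= 100 * N%:R.
  by have := sqr_ge0 (james_norm N a - james_norm N y); lra.
have : n%:R * (N%:R / 2) <= K * (100 * N%:R).
  apply: le_trans ay (le_trans formK _).
  by rewrite -mulrA ler_pM2l.
rewrite mulrCA mulrC mulrA ler_pM2r //; lra.
Qed.
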